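(* Let $G$ be a locally compact periodic topologically quasihamiltonian group, and let $\pi(G)$ be the set of primes $p$ for which $G$ has a nontrivial $p$-element. Then for each $p\in\pi(G)$ the set $G_p$ of $p$-elements is a topologically quasihamiltonian locally compact $p$-group (in particular a closed subgroup), and there are compact open subgroups $U_p\subseteq G_p$ such that $$G\cong\prod_{p\in\pi(G)}^{\mathrm{loc}}(G_p,U_p).$$ Conversely, every group isomorphic to a local product $\prod^{\mathrm{loc}}_{p\in\sigma}(G_p,U_p)$, where $\sigma$ is a set of primes, each $G_p$ is a topologically quasihamiltonian locally compact $p$-group and $U_p\subseteq G_p$ is a compact open subgroup, is topologically quasihamiltonian.
   Context: A topological group $G$ is periodic if it is locally compact, totally disconnected, and $\overline{\langle g\rangle}$ is compact for every $g$. For $g$ in such $G$, $\overline{\langle g\rangle}\cong\prod_qM_q$ with $M_q$ its $q$-primary component; $g$ is a $p$-element if $M_q=\{1\}$ for all $q\ne p$. A locally compact $p$-group is a periodic group all of whose elements are $p$-elements. $G$ is topologically quasihamiltonian if $\overline{XY}=\overline{YX}$ for all closed subgroups $X,Y$. Local product: for locally compact groups $G_j$ with compact open subgroups $C_j$, $\prod^{\mathrm{loc}}_j(G_j,C_j)$ is the subgroup of $\prod_jG_j$ of tuples with $g_j\notin C_j$ for only finitely many $j$, with the unique group topology making $\prod_jC_j$ (Tychonoff topology) an open subgroup. *)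

(* Defs.v *)
From HB Require Import structures.
From mathcomp Require Import all_boot all_order all_algebra.
From mathcomp Require Import all_classical topology.

Set Implicit Arguments.
Unset Strict Implicit.
Unset Printing Implicit Defensive.

Local Open Scope classical_set_scope.

(** A topological group: a topological space with a group law whose
    multiplication and inversion are continuous.  (Hausdorffness and local
    compactness are imposed separately, see [periodic_on].) *)
Record tgroup := TGroup {
  tg_car :> topologicalType;
  tg_mul : tg_car -> tg_car -> tg_car;
  tg_inv : tg_car -> tg_car;
  tg_one : tg_car;
  tg_mulA : forall x y z, tg_mul x (tg_mul y z) = tg_mul (tg_mul x y) z;
  tg_mul1 : forall x, tg_mul tg_one x = x;
  tg_mulV : forall x, tg_mul (tg_inv x) x = tg_one;
  tg_mul_cont : continuous (fun p : tg_car * tg_car => tg_mul p.1 p.2);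
  tg_inv_cont : continuous tg_inv
}.

Section TGroupDefs.
Variable G : tgroup.
Local Notation mul := (@tg_mul G).
Local Notation inv := (@tg_inv G).
Local Notation one := (@tg_one G).

Definition gpown (x : G) (n : nat) : G := iter n (mul x) one.
Definition gpowz (x : G) (z : int) : G :=
  match z with Posz n => gpown x n | Negz n => inv (gpown x n.+1) end.

Definition cyc (g : G) : set G := range (gpowz g).

Definition setmul (X Y : set G) : set G :=
  [set z | exists x y, X x /\ Y y /\ z = mul x y].

Definition subgroup (S : set G) : Prop :=
  [/\ S one, (forall x y, S x -> S y -> S (mul x y)) & (forall x, S x -> S (inv x))].

(** Notions relative to a subset S (carrying the subspace topology);
    for the whole group take S = setT. *)
Definition closed_in (S X : set G) : Prop := closure X `&` S `<=` X.
Definition rel_open_in (S X : set G) : Prop :=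
  exists O : set G, open O /\ X = O `&` S.

Definition hausdorff_on (S : set G) : Prop :=
  forall x y, S x -> S y -> x <> y ->
    exists U V : set G, [/\ open U, open V, U x, V y & U `&` V = set0].

Definition locally_compact_on (S : set G) : Prop :=
  forall x, S x -> exists K : set G,
    [/\ compact K, K `<=` S & exists O : set G, [/\ open O, O x & O `&` S `<=` K]].

Definition periodic_on (S : set G) : Prop :=
  [/\ subgroup S, hausdorff_on S, locally_compact_on S,
      totally_disconnected S &
      forall g, S g -> compact (closure (cyc g) `&` S)].

Definition primary_comp (S : set G) (q : nat) (g : G) : set G :=
  [set x | (closure (cyc g) `&` S) x /\
           (fun n : nat => gpown x (q ^ n)) @ \oo --> one].

Definition p_elt_on (S : set G) (p : nat) (g : G) : Prop :=
  forall q : nat, prime q -> q <> p -> primary_comp S q g = [set one].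

Definition lc_pgroup_on (S : set G) (p : nat) : Prop :=
  periodic_on S /\ forall g, S g -> p_elt_on S p g.

Definition tqh_on (S : set G) : Prop :=
  forall X Y : set G, X `<=` S -> Y `<=` S -> subgroup X -> subgroup Y ->
    closed_in S X -> closed_in S Y ->
    closure (setmul X Y) `&` S = closure (setmul Y X) `&` S.

Definition prime_set : set nat :=
  [set p | prime p /\ exists g : G, g <> one /\ p_elt_on setT p g].

Definition p_elts (p : nat) : set G := [set g | p_elt_on setT p g].

End TGroupDefs.

(** H is isomorphic (as a topological group) to the local product
    prod^loc_j (S j, C j), where S j is a subgroup of the topological group
    K j carrying the subspace topology and C j a compact open subgroup of S j.
    The local product is the group of tuples t in prod_j S j with t j in C j
    for all but finitely many j, topologised so that P = prod_j C j with the
    Tychonoff topology is an open subgroup.  Accordingly, phi is a group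
    isomorphism of H onto that group, phi^-1(P) is open in H, and phi
    restricts to a homeomorphism phi^-1(P) -> P (Tychonoff topology, i.e.
    subspace topology of the product topology). *)
Definition localprod_iso (H : tgroup) (I : Type) (K : I -> tgroup)
    (S C : forall j, set (K j)) : Prop :=
  let P : set (forall j, K j) := [set t | forall j, C j (t j)] in
  exists phi : H -> forall j, K j,
  [/\ forall x y, phi (tg_mul x y) = (fun j => tg_mul (phi x j) (phi y j)),
      injective phi,
      forall t : forall j, K j, (exists x, phi x = t) <->
        ((forall j, S j (t j)) /\ finite_set [set j | ~ C j (t j)]),
      open (phi @^-1` P) &
      forall W : set H, W `<=` phi @^-1` P ->
        (open W <-> exists O : set (prod_topology (fun j => (K j : topologicalType))),
                      open O /\ phi @` W = O `&` P)].

Arguments prime_set : clear implicits.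
Arguments p_elts : clear implicits.
Arguments localprod_iso : clear implicits.

(* Main.v *)
Require Import Defs.
From HB Require Import structures.
From mathcomp Require Import all_boot all_order all_algebra all_fingroup cyclic.
From mathcomp Require Import all_classical topology.

(** Call x a pi-element if, modulo every open subgroup, some pi-number kills it.  Compact open
    subgroups form a base at 1, and compact subgroups X, Y of a topologically quasihamiltonian group
    satisfy XY = YX.  Hence, for pi-elements x and y, cl<x>cl<y> is a compact group whose finite
    quotients are products of two cyclic pi-groups, so the pi-elements form a closed normal
    subgroup.  Elements g^(e_n), with e_n -> 1 in the p-adic integers and e_n -> 0 in the
    q-adic integers for q <> p, accumulate at the p-part of g.  As p-elements and p'-elements
    intersect trivially, taking p-parts is a continuous endomorphism, and the p-parts together
    give the isomorphism onto the local product.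

    Conversely, in a local product H the same exponents put the coordinate embedding of x_p into
    every closed subgroup containing x.  A closed subgroup X thus has closed coordinate groups X_p,
    and x_p y_p is a limit of elements of Y_p X_p for each p.  A basic neighbourhood of xy only
    constrains finitely many coordinates, where these approximations can be made. *)

Set Implicit Arguments.
Unset Strict Implicit.
Unset Printing Implicit Defensive.

Local Open Scope classical_set_scope.

(** * Compact open neighbourhoods in totally disconnected spaces *)

Section LocallyCompactSpaces.
Variable T : topologicalType.

(** Otherwise the sets B ∩ cl U, for U in F, generate a proper filter on B, and a cluster point of
    it in B lies in every cl U. *)
Lemma compact_avoid_closure (F : set_system T) (B : set T) :
  Filter F -> compact B -> (forall b, B b -> exists2 U, F U & ~ closure U b) ->
  exists2 U, F U & B `&` closure U = set0.
Proof.
move=> FF cB h; apply: contrapT => hn.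
pose H := filter_from F (fun U => B `&` closure U).
have HF : Filter H.
  apply: filter_from_filter; first by exists setT; exact: filterT.
  move=> U V FU FV; exists (U `&` V); first exact: filterI.
  by move=> b [Bb cb]; have [? ?] := closureI cb.
have PH : ProperFilter H.
  apply: filter_from_proper => // U FU; apply/set0P/eqP => e.
  by apply: hn; exists U.
have HB : H B by exists setT; [exact: filterT | move=> ? []].
have [b [Bb bH]] := cB H PH HB.
have [U FU []] := h b Bb.
rewrite [closure U](closure_id _).1; last exact: closed_closure.
move=> V Vb; have HU : H (B `&` closure U) by exists U.
by have [c [[_ ?] ?]] := bH _ _ HU Vb; exists c.
Qed.

(** [compact_avoid_closure] is used twice: against B with the neighbourhoods of a point of A, then
    against A with the neighbourhoods of B. *)
Lemma compact_separation (A B : set T) :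
  hausdorff_space T -> compact A -> compact B -> A `&` B = set0 ->
  exists U V, [/\ open U, open V, A `<=` U, B `<=` V & U `&` V = set0].
Proof.
move=> hT cA cB AB0.
have [V sV AV] : exists2 V, set_nbhs B V & A `&` closure V = set0.
  apply: compact_avoid_closure => // a Aa.
  have [U aU BU] : exists2 U, nbhs a U & B `&` closure U = set0.
    apply: compact_avoid_closure => // b Bb.
    have ab : a != b.
      apply/eqP => e; have : (A `&` B) a by split=> //; rewrite e.
      by rewrite AB0.
    move: hT; rewrite open_hausdorff => /(_ _ _ ab) [[U V] /= [/set_mem Ua /set_mem Vb]].
    move=> [oU oV UV]; exists U; first exact: open_nbhs_nbhs.
    move=> /(_ V (open_nbhs_nbhs (conj oV Vb))) [c].
    by rewrite (eqP UV).
  exists (~` closure U).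
    move=> b Bb; apply: open_nbhs_nbhs; split.
      by rewrite openC; exact: closed_closure.
    move=> Ub; have : (B `&` closure U) b by [].
    by rewrite BU.
  by move=> /(_ U aU) [c [nUc Uc]]; apply: nUc; exact: subset_closure.
have [W [oW BW WV]] := (set_nbhsP B V).1 sV.
exists (~` closure V), W; split => //.
- by rewrite openC; exact: closed_closure.
- by apply/disjoints_subset.
- apply/seteqP; split => // x [nx Wx]; apply: nx; apply: subset_closure.
  exact: WV.
Qed.

(** The quasi-component Q of x in K, the intersection of the sets clopen in K that contain x, is
    connected and hence equal to {x}. By compactness, one of these clopen sets already fits into a
    given open set around Q. *)
Lemma compact_open_base (K O : set T) (x : T) :
  hausdorff_space T -> totally_disconnected [set: T] -> compact K ->
  nbhs x K -> nbhs x O ->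
  exists A : set T, [/\ open A, compact A, A x & A `<=` O].
Proof.
move=> hT tdT cK xK xO.
have clK : closed K by exact: compact_closed.
pose rc A := [/\ closed A, closed (K `\` A), A `<=` K & A x].
have rcK : rc K.
  by split => //; [rewrite setDv; exact: closed0 | exact: nbhs_singleton].
have rcI A B : rc A -> rc B -> rc (A `&` B).
  move=> [cA cA' AK Ax] [cB cB' BK Bx]; split => //; first exact: closedI.
    by rewrite setDIr; exact: closedU.
  by move=> y [/AK].
pose Q := \bigcap_(A in rc) A.
have clQ : closed Q by apply: closed_bigI => A [].
have Qx : Q x by move=> A [].
have shrink O' : open O' -> Q `<=` O' -> exists2 A, rc A & A `<=` O'.
  move=> oO' QO'; apply: contrapT => hn.
  pose H := filter_from rc (fun A => A `\` O').
  have HF : Filter H.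
    apply: filter_from_filter; first by exists K.
    move=> A B rA rB; exists (A `&` B); first exact: rcI.
    by move=> y [[Ay By] Oy].
  have PH : ProperFilter H.
    apply: filter_from_proper => // A rA; apply/set0P/eqP => e; apply: hn.
    by exists A => // y Ay; apply: contrapT => nO; rewrite -[False]/(set0 y) -e.
  have HK : H K by exists K => // y [].
  have [y [Ky yH]] := cK H PH HK.
  have yA A : rc A -> (A `\` O') y.
    move=> rA; have cl : closed (A `\` O').
      by apply: closedI; [case: rA | rewrite closedC].
    rewrite ((closure_id (A `\` O')).1 cl) => V Vy.
    by apply: yH => //; exists A.
  have [_ nO] := yA K rcK; apply: nO; apply: QO' => A rA.
  by have [] := yA A rA.
(* If Q splits into two pieces, they are compact and have disjoint open neighbourhoods U and V,
   whose union contains some A in [rc]. Removing V from A leaves a member of [rc] that misses the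
   piece without x, although it must contain Q. *)
have conQ : connected Q.
  apply: contrapT => /connectedPn [E [E0 QE [sE1 sE2]]].
  have clE b : closed (E b).
    rewrite closure_id; apply/seteqP; split; first exact: subset_closure.
    move=> y yE; have : Q y.
      rewrite ((closure_id Q).1 clQ); move: yE; apply: closureS; rewrite QE.
      by case: b; [exact: subsetUr | exact: subsetUl].
    rewrite QE => -[] yE'; case: b yE => yE //; exfalso.
      by have : (E false `&` closure (E true)) y by []; rewrite sE2.
    by have : (closure (E false) `&` E true) y by []; rewrite sE1.
  have EQ b : E b `<=` Q.
    by rewrite QE; case: b; [exact: subsetUr | exact: subsetUl].
  have EK b : E b `<=` K by move=> y /EQ /(_ K rcK).
  have cE b : compact (E b) by exact: subclosed_compact cK (EK b).
  have [b bx] : exists b, E b x.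
    by move: Qx; rewrite QE => -[]; [exists false | exists true].
  have dE : E b `&` E (~~ b) = set0.
    have d := separated_disjoint (conj sE1 sE2).
    by case: {bx}b => //=; rewrite setIC.
  have [U [V [oU oV EU EV UV]]] := compact_separation hT (cE b) (cE (~~ b)) dE.
  have [A rA AUV] : exists2 A, rc A & A `<=` U `|` V.
    apply: shrink; first exact: openU.
    rewrite QE => y yE.
    have {yE} [yE|yE] : E b y \/ E (~~ b) y.
      by case: b {bx dE EU EV} yE => -[]; by [left | right].
    - by left; exact: EU.
    - by right; exact: EV.
  have Vx : ~ V x.
    by move=> Vx; rewrite -[False]/(set0 x) -UV; split => //; exact: EU.
  have rA' : rc (A `\` V).
    case: rA => cA cA' AK Ax; split => //.
    - by apply: closedI => //; rewrite closedC.
    - have -> : K `\` (A `\` V) = (K `\` A) `|` (A `\` U).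
        apply/seteqP; split => y.
          move=> [Ky nAV]; have [Ay|nAy] := pselect (A y); last by left.
          right; split => // Uy; apply: nAV; split => // Vy.
          by rewrite -[False]/(set0 y) -UV.
        move=> [[Ky nA]|[Ay nU]]; split => //; [by case | exact: AK |].
        by move=> [_ nV]; have [] := AUV y Ay.
      by apply: closedU => //; apply: closedI => //; rewrite closedC.
    - by move=> y [/AK].
  have [z Ez] := E0 (~~ b).
  by have [_ nVz] := EQ _ _ Ez _ rA'; apply: nVz; exact: EV.
have Q1 : Q `<=` [set x].
  by rewrite -(tdT x) // => y Qy; exists Q.
(* A subset of the interior of K that is clopen in K is open in the whole space. *)
have [A rA AKO] : exists2 A, rc A & A `<=` K° `&` O°.
  apply: shrink; first by apply: openI; exact: open_interior.
  by move=> y /Q1 ->; split.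
case: (rA) => cA cA' AK Ax.
exists A; split => //.
- have -> : A = K° `&` ~` (K `\` A).
    apply/seteqP; split => y; first by move=> Ay; split; [case: (AKO y Ay) | case].
    by move=> [Ky nA]; apply: contrapT => nAy; apply: nA; split => //; exact: interior_subset.
  by apply: openI; [exact: open_interior | rewrite openC].
- exact: subclosed_compact cK AK.
- by move=> y /AKO [_]; exact: interior_subset.
Qed.

End LocallyCompactSpaces.

(** * Subgroups, cyclic subgroups and closures in a topological group *)

Section GroupLaws.
Variable G : tgroup.
Implicit Type x : G.

Lemma tg_mulxV x : tg_mul x (tg_inv x) = tg_one G.
Proof.
by rewrite -[LHS]tg_mul1 -{1}(tg_mulV (tg_inv x)) -tg_mulA (tg_mulA _ x)
  tg_mulV tg_mul1 tg_mulV.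
Qed.

Lemma tg_mulx1 x : tg_mul x (tg_one G) = x.
Proof. by rewrite -(tg_mulV x) tg_mulA tg_mulxV tg_mul1. Qed.

End GroupLaws.

(** Puts the MathComp group structure on the carrier, so that its notation and its lemmas on powers,
    conjugates and commuting elements apply. *)
#[non_forgetful_inheritance]
HB.instance Definition _ (G : tgroup) :=
  isGroup.Build (Topological.sort (tg_car G))
    (@tg_mulA G) (@tg_mul1 G) (@tg_mulx1 G) (@tg_mulV G) (@tg_mulxV G).

Local Open Scope group_scope.

Section TopologicalGroup.
Variable G : tgroup.
Implicit Types (x y z g : G) (S U V W X Y : set G).

Lemma tg_mulE x y : tg_mul x y = x * y. Proof. by []. Qed.

Lemma gpownE x n : gpown x n = x ^+ n.
Proof. exact: iter_mulg_1. Qed.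

Section Subgroups.
Variable S : set G.
Hypothesis sS : subgroup S.

Lemma subgroup1 : S 1. Proof. by case: sS. Qed.

Lemma subgroupM x y : S x -> S y -> S (x * y).
Proof. by case: sS => _ h _; exact: h. Qed.

Lemma subgroupV x : S x -> S x^-1.
Proof. by case: sS => _ _ h; exact: h. Qed.

Lemma subgroupVE x : S x^-1 -> S x.
Proof. by move/subgroupV; rewrite invgK. Qed.

Lemma subgroupX x n : S x -> S (x ^+ n).
Proof.
move=> Sx; elim: n => [|n ih]; first by rewrite expg0; exact: subgroup1.
by rewrite expgS; exact: subgroupM.
Qed.

Lemma subgroupMl x y : S x -> S (x * y) -> S y.
Proof. by move=> /subgroupV Sx /(subgroupM Sx); rewrite mulKg. Qed.

Lemma subgroupMr x y : S y -> S (x * y) -> S x.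
Proof. by move=> /subgroupV Sy /subgroupM -/(_ _ Sy); rewrite mulgK. Qed.

Lemma subgroup_coset x y : S (x^-1 * y) -> S x <-> S y.
Proof.
move=> h; split=> [Sx|Sy]; first by rewrite -(mulVKg x y); exact: subgroupM.
apply: subgroupVE; exact: subgroupMr Sy h.
Qed.

Lemma cyc_sub_subgroup x : S x -> cyc x `<=` S.
Proof.
move=> Sx _ [[n|n] _ <-]; rewrite /gpowz gpownE; first exact: subgroupX.
by apply: subgroupV; exact: subgroupX.
Qed.

End Subgroups.

Lemma subgroupI X Y : subgroup X -> subgroup Y -> subgroup (X `&` Y).
Proof.
move=> sX sY; split; first by split; exact: subgroup1.
- by move=> x y [Xx Yx] [Xy Yy]; split; exact: subgroupM.
- by move=> x [Xx Yx]; split; exact: subgroupV.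
Qed.

Lemma cyc_pow x n : cyc x (x ^+ n).
Proof. by exists (Posz n) => //; exact: gpownE. Qed.

Lemma cyc_commute x y : cyc x y -> commute x y.
Proof.
move=> [[n|n] _ <-]; rewrite /gpowz gpownE; first exact/commuteX/commute_refl.
by apply: commuteV; exact/commuteX/commute_refl.
Qed.

(** Replaces integer arithmetic on exponents when [cyc x] is shown to be a subgroup. *)
Lemma expg_sub x m n : exists k, cyc x k /\ x ^+ m = k * x ^+ n.
Proof.
case: (leqP n m) => h.
  by exists (x ^+ (m - n)); split; [exact: cyc_pow | rewrite -expgnDr subnK].
exists (x ^- (n - m)); split; last first.
  by rewrite -{2}(subnKC (ltnW h)) addnC expgnDr mulKg.
case e : (n - m)%N => [|k].
  by rewrite expg0 invg1 -(expg0 x); exact: cyc_pow.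
by exists (Negz k) => //; rewrite -gpownE.
Qed.

Lemma cyc_subgroup x : subgroup (cyc x).
Proof.
have cV y : cyc x y -> cyc x y^-1.
  move=> [[n|n] _ <-]; rewrite /gpowz gpownE; last by rewrite invgK; exact: cyc_pow.
  by have [k [ck]] := expg_sub x 0 n; rewrite expg0 => /esym/mulg1_eq/(canRL invgK) <-.
have cX m n : cyc x (x ^+ m * x ^- n).
  by have [k [ck ->]] := expg_sub x m n; rewrite mulgK.
have cX' m n : cyc x (x ^- n * x ^+ m).
  suff -> : x ^- n * x ^+ m = x ^+ m * x ^- n by [].
  by apply/commute_sym/commuteV/commuteX2/commute_refl.
split=> //; first by have := cyc_pow x 0; rewrite expg0.
move=> _ _ [[m|m] _ <-] [[n|n] _ <-]; rewrite /gpowz tg_mulE !gpownE.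
- by rewrite -expgnDr; exact: cyc_pow.
- exact: cX m n.+1.
- exact: cX' n m.+1.
- rewrite -[X in cyc x X]/(x ^- m.+1 * x ^- n.+1) -invgM -expgnDr; by apply: cV; exact: cyc_pow.
Qed.

Lemma mul_continuous2 : continuous (fun p : G * G => p.1 * p.2).
Proof. exact: (@tg_mul_cont G). Qed.

Lemma mull_continuous x : continuous (fun y => x * y).
Proof.
move=> y U /(@mul_continuous2 (x, y)) [[A B] /= [xA yB] AB].
by apply: filterS yB => z Bz; apply: (AB (x, z)); split=> //; exact: nbhs_singleton.
Qed.

Lemma mulr_continuous x : continuous (fun y => y * x).
Proof.
move=> y U /(@mul_continuous2 (y, x)) [[A B] /= [yA xB] AB].
by apply: filterS yA => z Az; apply: (AB (z, x)); split=> //; exact: nbhs_singleton.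
Qed.

Lemma conj_continuous x : continuous (fun y => y ^ x).
Proof.
move=> y; rewrite /conjg.
apply: (@continuous_comp _ _ _ (fun y => y * x) (fun y => x^-1 * y)).
  exact: mulr_continuous.
exact: mull_continuous.
Qed.

Lemma nbhs_mull x y U : nbhs (x * y) U -> nbhs y [set z | U (x * z)].
Proof. exact: mull_continuous. Qed.

Lemma nbhs_mull1 x U : nbhs x U -> nbhs (1 : G) [set z | U (x * z)].
Proof. by move=> h; apply: nbhs_mull; rewrite mulg1. Qed.

Lemma nbhs_coset x V : nbhs (1 : G) V -> nbhs x [set z | V (x^-1 * z)].
Proof. by move=> V1; apply: nbhs_mull; rewrite mulVg. Qed.

Lemma nbhs_subgroup_open U : nbhs (1 : G) U -> subgroup U -> open U.
Proof.
move=> U1 sU; rewrite openE => x Ux; apply: filterS (nbhs_coset x U1) => z /=.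
by move=> h; apply/(subgroup_coset sU h).
Qed.

Definition opensub U := open U /\ subgroup U.

Lemma opensub_nbhs U : opensub U -> nbhs (1 : G) U.
Proof. by move=> [oU /subgroup1 U1]; exact: open_nbhs_nbhs. Qed.

Lemma opensubI U V : opensub U -> opensub V -> opensub (U `&` V).
Proof. by move=> [oU sU] [oV sV]; split; [exact: openI | exact: subgroupI]. Qed.

Lemma opensubJ U x : opensub U -> opensub [set y | U (y ^ x)].
Proof.
move=> [oU sU]; split.
  by apply: (open_comp _ oU) => y _; exact: conj_continuous.
split=> /=.
- by rewrite -[tg_one G]/(1 : G) conj1g; exact: subgroup1.
- by move=> y z Uy Uz; rewrite tg_mulE conjMg; exact: subgroupM.
- by move=> y Uy; rewrite -[tg_inv y]/(y^-1) conjVg; exact: subgroupV.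
Qed.

Lemma opensub_closed U : opensub U -> closed U.
Proof.
move=> oU x xU; have [y [Uy /= h]] := xU _ (nbhs_coset x (opensub_nbhs oU)).
by apply/(subgroup_coset oU.2 h).
Qed.

Lemma closure_coset S U x : opensub U -> closure S x ->
  exists2 y, S y & U (x^-1 * y).
Proof.
move=> oU xS; have [y [Sy /= h]] := xS _ (nbhs_coset x (opensub_nbhs oU)).
by exists y.
Qed.

Lemma closure_subgroup S : subgroup S -> subgroup (closure S).
Proof.
move=> sS; split.
- by apply: subset_closure; exact: subgroup1.
- move=> x y xS yS U.
  move=> /(@mul_continuous2 (x, y)) [[A B] /= [xA yB] AB].
  have [a [Sa Aa]] := xS A xA; have [b [Sb Bb]] := yS B yB.
  exists (a * b); split; first exact: subgroupM.
  exact: (AB (a, b)).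
- move=> x xS U /(@tg_inv_cont G x) Ux; have [a [Sa Ua]] := xS _ Ux.
  by exists a^-1; split => //; exact: subgroupV.
Qed.

Lemma closed_sub_closure S X : closed X -> S `<=` X -> closure S `<=` X.
Proof. by move=> cX SX; rewrite ((closure_id X).1 cX); exact: closureS. Qed.

Lemma setmul_compact X Y : compact X -> compact Y -> compact (setmul X Y).
Proof.
move=> cX cY.
have -> : setmul X Y = (fun p : G * G => p.1 * p.2) @` (X `*` Y).
  apply/seteqP; split => z.
    by move=> [x [y [Xx [Yy ->]]]]; exists (x, y).
  by move=> [[x y] [/= Xx Yy] <-]; exists x, y.
apply: continuous_compact; last exact: compact_setX.
by apply: continuous_subspaceT; exact: mul_continuous2.
Qed.

End TopologicalGroup.

(** * Finite quotients of compact subgroups *)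

Section FiniteQuotient.
Variable G : tgroup.
Implicit Types (x y z g r : G) (S U V W X Y K : set G).

(** For s a list of coset representatives of W modulo U, this set cuts out of W the kernel of the
    action on the cosets. *)
Lemma opensub_core U (s : seq G) :
  opensub U -> opensub [set x | forall r, r \in s -> U (x ^ r)].
Proof.
move=> oU; elim: s => [|r s ih].
  have -> : [set x | forall r, r \in [::] -> U (x ^ r)] = [set: G].
    by apply/seteqP; split.
  by split; [exact: openT | split].
have -> : [set x | forall r0, r0 \in r :: s -> U (x ^ r0)] =
    [set x | U (x ^ r)] `&` [set x | forall r, r \in s -> U (x ^ r)].
  apply/seteqP; split => x /=.
    move=> h; split; first by apply: h; rewrite mem_head.
    by move=> t ts; apply: h; rewrite inE ts orbT.
  by move=> [h1 h2] t; rewrite inE => /predU1P[->|/h2].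
by apply: opensubI => //; exact: opensubJ.
Qed.

(** If no finite list suffices, the uncovered parts of W generate a proper filter. A cluster point w
    of it contradicts the part left uncovered by the one-element list of w. *)
Lemma compact_finite_cosets W U : compact W -> opensub U ->
  exists s : seq G, (forall r, r \in s -> W r) /\
    forall w, W w -> exists2 r, r \in s & U (r^-1 * w).
Proof.
move=> cW oU; apply: contrapT => hn.
pose D := [set s : seq G | forall r, r \in s -> W r].
pose B (s : seq G) := [set w | W w /\ forall r, r \in s -> ~ U (r^-1 * w)].
have HF : Filter (filter_from D B).
  apply: filter_from_filter; first by exists [::].
  move=> s t Ds Dt; exists (s ++ t).
    by move=> r; rewrite mem_cat => /orP [/Ds|/Dt].
  move=> w [Ww h]; split; split => // r rs; apply: h.
    by rewrite mem_cat rs.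
  by rewrite mem_cat rs orbT.
have PH : ProperFilter (filter_from D B).
  apply: filter_from_proper => // s Ds; apply: contrapT => e; apply: hn.
  exists s; split => // w Ww; apply: contrapT => h; apply: e; exists w.
  by split => // r rs rU; apply: h; exists r.
have [|w [Ww cl]] := cW _ PH; first by exists [::] => // w [].
have [|v [[_ h] /= wv]] := cl (B [:: w]) _ _ (nbhs_coset w (opensub_nbhs oU)).
  by exists [:: w] => // r; rewrite inE => /eqP ->.
by apply: (h w) => //; rewrite mem_head.
Qed.

(* W acts by translation on its finitely many cosets modulo U; a permutation
   representation avoids constructing quotient groups. *)
Lemma finite_quotient W U : compact W -> subgroup W -> opensub U ->
  exists (T : finType) (rho : G -> {perm T}) (K : set G),
  [/\ opensub K, K `<=` U,
      forall x y, W x -> W y -> rho (x * y) = rho x * rho y &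
      forall x, W x -> (rho x = 1) <-> K x].
Proof.
move=> cW sW oU; have [s [sWs cov]] := compact_finite_cosets cW oU.
have sU := oU.2.
pose co r : set G := [set z | U (r^-1 * z)].
have coP r r' : U (r^-1 * r') -> co r = co r'.
  move=> h; apply/seteqP; split => z; rewrite /co /=.
    move=> rz; apply: (subgroupMl sU h).
    by rewrite -mulgA mulVKg.
  by move=> rz; rewrite -(mulVKg r' z) mulgA; exact: subgroupM.
pose cs := [seq co r | r <- s].
(* This is translation by w^-1, which matches the left-to-right product of permutations. The default
   C of [insubd] is not reached for w in W, by [fE]. *)
pose f w (C : seq_sub cs) : seq_sub cs := insubd C [set z | val C (w * z)].
have fE w C : W w -> val (f w C) = [set z | val C (w * z)].
  move=> Ww; rewrite /f insubdK //; have /mapP [r rs ->] := valP C.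
  have [r' r's h] : exists2 r', r' \in s & U (r'^-1 * (w^-1 * r)).
    apply: cov; apply: subgroupM => //; first exact: subgroupV.
    exact: sWs.
  apply/mapP; exists r' => //; rewrite (coP _ _ h).
  by apply/seteqP; split => z; rewrite /co /= invgM invgK mulgA.
have finj w : W w -> injective (f w).
  move=> Ww C D /(congr1 val); rewrite !fE // => e; apply: val_inj.
  apply/seteqP; split => z h.
    have : [set z | val C (w * z)] (w^-1 * z) by rewrite /= mulVKg.
    by rewrite e /= mulVKg.
  have : [set z | val D (w * z)] (w^-1 * z) by rewrite /= mulVKg.
  by rewrite -e /= mulVKg.
(* Injectivity of [f w] is known only for w in W, so [rho] is set to 1 elsewhere. *)
pose rho w : {perm seq_sub cs} :=
  if pselect (W w) is left h then perm (finj w h) else 1.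
have rhoE w C : W w -> val (rho w C) = [set z | val C (w * z)].
  by move=> Ww; rewrite /rho; case: pselect => // h; rewrite permE fE.
exists (seq_sub cs), rho, [set x | forall r, r \in s -> U (x ^ r)]; split.
- exact: opensub_core.
(* The representative r of the coset of 1 lies in U, so x ^ r in U forces x in U. *)
- move=> x /= h; have [r rs rU] := cov 1 (subgroup1 sW).
  move: rU; rewrite mulg1 => rU.
  have := h r rs; rewrite conjgE => /(subgroupMl sU rU).
  by apply: subgroupMr => //; exact: subgroupVE.
- move=> x y Wx Wy; apply/permP => C; apply: val_inj.
  rewrite permM !rhoE //; last exact: subgroupM.
  by apply/seteqP; split => z /=; rewrite mulgA.
- move=> x Wx; split => /= [e r rs|h].
    have coS : co r \in cs by apply: map_f.
    have := rhoE x (SeqSub coS) Wx; rewrite e perm1 /= => ee.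
    have : co r r by rewrite /co /= mulVg; exact: subgroup1.
    by rewrite ee /co /= conjgE.
  apply/permP => C; apply: val_inj; rewrite rhoE // perm1.
  have /mapP [r rs ->] := valP C.
  have rx := h r rs; rewrite conjgE in rx.
  apply/seteqP; split => z; rewrite /co /=.
    by move=> h2; apply: (subgroupMl sU rx); rewrite -!mulgA mulVKg.
  by move=> h2; rewrite -(mulVKg r z) !mulgA -(mulgA r^-1 x r) -mulgA; exact: subgroupM.
Qed.

End FiniteQuotient.

(** * Closed subgroups of pi-elements in a periodic group *)

Section PeriodicGroup.
Variable G : tgroup.
Implicit Types (x y z g h : G) (S U V W X Y : set G) (pi : nat_pred).
Hypothesis perG : periodic_on [set: G].

Lemma periodic_hausdorff : hausdorff_space G.
Proof.
rewrite open_hausdorff => x y xy; case: perG => _ hG _ _ _.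
have [U [V [oU oV Ux Vy UV]]] := hG x y I I (elimN eqP xy).
by exists (U, V); [split; apply/mem_set | split => //; apply/eqP].
Qed.

Lemma closure_cyc_compact g : compact (closure (cyc g)).
Proof. by case: perG => _ _ _ _ /(_ g I); rewrite setIT. Qed.

Lemma closure_cyc_subgroup g : subgroup (closure (cyc g)).
Proof. exact/closure_subgroup/cyc_subgroup. Qed.

Lemma closure_cyc_id g : closure (cyc g) g.
Proof. by apply: subset_closure; rewrite -[X in cyc g X]expg1; exact: cyc_pow. Qed.

Lemma closure_cyc_sub g S : closed S -> subgroup S -> S g -> closure (cyc g) `<=` S.
Proof. by move=> cS sS Sg; apply: closed_sub_closure => //; exact: cyc_sub_subgroup. Qed.

(* In a compact open A containing 1, the x such that Ax and Ax^-1 are contained in A form an open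
   subgroup contained in A. *)
Lemma opensub_base S : nbhs (1 : G) S ->
  exists U, [/\ opensub U, compact U & U `<=` S].
Proof.
move=> S1; case: (perG) => _ _ lcG tdG _.
have [K [cK _ [N [oN N1 NK]]]] := lcG 1 I.
have K1 : nbhs (1 : G) K.
  by apply: (@filterS _ _ _ N); [rewrite -[N]setIT | exact: open_nbhs_nbhs].
have [A [oA cA A1 AS]] := compact_open_base periodic_hausdorff tdG cK K1 S1.
pose U := [set x | forall a, A a -> A (a * x) /\ A (a * x^-1)].
have sU : subgroup U.
  split => /=.
  - by move=> a Aa; rewrite -[tg_one G]/(1 : G) invg1 mulg1.
  - move=> x y Ux Uy a Aa; rewrite tg_mulE invgM !mulgA; split.
      exact: (Uy _ (Ux _ Aa).1).1.
    exact: (Ux _ (Uy _ Aa).2).2.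
  - by move=> x Ux a /Ux []; rewrite -[tg_inv x]/(x^-1) invgK.
have UA : U `<=` A by move=> x /(_ _ A1) []; rewrite mul1g.
have U1 : nbhs (1 : G) U.
  (* Tube argument: each a in A has a neighbourhood P and 1 a neighbourhood Q with PQ in A, and
     compactness of A makes Q uniform. *)
  have h : \forall x \near (1 : G), A `<=` [set a | A (a * x)].
    apply: ((compact_near_coveringP A).1 cA _ _ (fun x a => A (a * x))) => a Aa.
    have : nbhs (a * 1) A by rewrite mulg1; exact: open_nbhs_nbhs.
    move=> /(@mul_continuous2 G (a, 1)) [[P Q] /= [aP Q1] PQ].
    by exists (P, Q) => // -[b x] /= [Pb Qx]; exact: (PQ (b, x)).
  have h' : \forall x \near (1 : G), A `<=` [set a | A (a * x^-1)].
    have : nbhs (1^-1 : G) [set x | A `<=` [set a | A (a * x)]].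
      by rewrite invg1.
    exact: (@tg_inv_cont G 1).
  apply: filterS (filterI h h') => x [h1 h2] a Aa.
  by split; [exact: h1|exact: h2].
have oU : opensub U by split => //; exact: nbhs_subgroup_open.
exists U; split => //; last exact: subset_trans AS.
exact: subclosed_compact (opensub_closed oU) cA UA.
Qed.

Lemma opensub_sep x : (forall U, opensub U -> U x) -> x = 1.
Proof.
move=> h; apply: periodic_hausdorff => A B xA B1.
have [U [oU _ UB]] := opensub_base B1.
by exists x; split; [exact: nbhs_singleton | by apply: UB; exact: h].
Qed.

Lemma cvg_pow1 (e : nat -> nat) x :
  (fun n => x ^+ e n) @ \oo --> (1 : G) <->
  forall U, opensub U -> \forall n \near \oo, U (x ^+ e n).
Proof.
split=> [cv U oU|h S S1]; first exact: cv _ (opensub_nbhs oU).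
have [U [oU _ US]] := opensub_base S1.
by apply: filterS (h U oU) => n; exact: US.
Qed.

(** An arbitrary [pi] lets p-elements and p'-elements be treated together; [p_eltP] links the case
    of one prime to [p_elt_on]. *)
Definition pielt pi x :=
  forall U, opensub U -> exists m, pi.-nat m /\ U (x ^+ m).

Lemma pielt1 pi : pielt pi 1.
Proof. by move=> U oU; exists 1%N; rewrite expg1; split => //; exact: subgroup1 oU.2. Qed.

Lemma pieltV pi x : pielt pi x -> pielt pi x^-1.
Proof.
move=> px U oU; have [m [pm Um]] := px U oU; exists m; split => //.
by rewrite expVgn; exact: subgroupV oU.2 _ Um.
Qed.

Lemma pieltJ pi x g : pielt pi x -> pielt pi (x ^ g).
Proof.
move=> px U oU; have [m [pm Um]] := px _ (opensubJ g oU); exists m; split => //.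
by rewrite -conjXg.
Qed.

Lemma subgroup_expg_dvd S x m n : subgroup S -> S (x ^+ m) -> (m %| n)%N -> S (x ^+ n).
Proof. by move=> sS Sm /dvdnP [k ->]; rewrite mulnC expgnA; exact: subgroupX. Qed.

Lemma subgroup_expg_coprime S x m n : subgroup S ->
  S (x ^+ m) -> S (x ^+ n) -> coprime m n -> S x.
Proof.
(* [egcdnP] expects a positive number; for m = 0, coprimality gives n = 1. *)
move=> sS; case: m => [|m] Sm Sn.
  by rewrite /coprime gcd0n => /eqP nE; rewrite nE expg1 in Sn.
move=> /eqP co; have [u v e _] := egcdnP n (ltn0Sn m); rewrite co in e.
have : S (x ^+ (v * n + 1)) by rewrite -e mulnC expgnA; exact: subgroupX.
rewrite expgnDr expg1; apply: subgroupMl => //.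
by rewrite mulnC expgnA; exact: subgroupX.
Qed.

Lemma pielt_disjoint pi x : pielt pi x -> pielt (pi^')%N x -> x = 1.
Proof.
move=> px px'; apply: opensub_sep => U oU.
have [m [pm Um]] := px U oU; have [n [pn Un]] := px' U oU.
exact: subgroup_expg_coprime oU.2 Um Un (pnat_coprime pm pn).
Qed.

Lemma pielt_sub pi pi' x : {subset pi <= pi'} -> pielt pi x -> pielt pi' x.
Proof.
move=> s px U oU; have [m [pm Um]] := px U oU; exists m; split => //.
by apply: sub_in_pnat pm => p _; exact: s.
Qed.

Hypothesis tqhG : tqh_on [set: G].

(** XY and YX are compact, hence closed, so the closures in [tqh_on] disappear. *)
Lemma compact_setmulC X Y : compact X -> compact Y -> subgroup X -> subgroup Y ->
  setmul X Y = setmul Y X.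
Proof.
move=> cX cY sX sY; have cl := compact_closed periodic_hausdorff.
have h := tqhG (@subsetT _ X) (@subsetT _ Y) sX sY.
have clI Z : compact Z -> closed_in [set: G] Z.
  by move=> /cl cZ; rewrite /closed_in setIT -((closure_id Z).1 cZ).
move: (h (clI X cX) (clI Y cY)); rewrite !setIT.
rewrite -((closure_id (setmul X Y)).1 _); last by apply: cl; exact: setmul_compact.
by rewrite -((closure_id (setmul Y X)).1 _); last by apply: cl; exact: setmul_compact.
Qed.

Lemma setmul_subgroup X Y : subgroup X -> subgroup Y ->
  setmul X Y = setmul Y X -> subgroup (setmul X Y).
Proof.
move=> sX sY XY; split.
- by exists 1, 1; split; [exact: subgroup1|split; [exact: subgroup1|rewrite tg_mulE mulg1]].
- move=> _ _ [x [y [Xx [Yy ->]]]] [x' [y' [Xx' [Yy' ->]]]].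
  have : setmul X Y (y * x') by rewrite XY; exists y, x'.
  move=> [x'' [y'' [Xx'' [Yy'' e]]]]; exists (x * x''), (y'' * y').
  split; [exact: subgroupM|split; first exact: subgroupM].
  by rewrite !tg_mulE in e *; rewrite -!mulgA (mulgA y) e -!mulgA.
- move=> _ [x [y [Xx [Yy ->]]]]; rewrite XY; exists y^-1, x^-1.
  by split; [exact: subgroupV|split; [exact: subgroupV|exact: invgM]].
Qed.

Lemma setmulEl X Y x : subgroup Y -> X x -> setmul X Y x.
Proof.
by move=> /subgroup1 Y1 Xx; exists x, 1; split=> //; split=> //; rewrite tg_mulE mulg1.
Qed.

Lemma setmulEr X Y y : subgroup X -> Y y -> setmul X Y y.
Proof.
by move=> /subgroup1 X1 Xy; exists 1, y; split=> //; split=> //; rewrite tg_mulE mul1g.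
Qed.

(** * Images and orders of elements in a finite permutation representation *)

Section Rep.
Variables (W : set G) (T : finType) (rho : G -> {perm T}) (K : set G).
Hypotheses (sW : subgroup W) (oK : opensub K)
  (rhoM : forall x y, W x -> W y -> rho (x * y) = rho x * rho y)
  (rhoK : forall x, W x -> (rho x = 1) <-> K x).

Lemma rep1 : rho 1 = 1.
Proof. by apply/rhoK; [exact: subgroup1 | exact: subgroup1 oK.2]. Qed.

Lemma repX x n : W x -> rho (x ^+ n) = rho x ^+ n.
Proof.
move=> Wx; elim: n => [|n ih]; first by rewrite !expg0 rep1.
by rewrite !expgS rhoM ?ih //; exact: subgroupX.
Qed.

Lemma repV x : W x -> rho x^-1 = (rho x)^-1.
Proof.
move=> Wx; apply/esym/mulg1_eq; rewrite -rhoM ?mulgV ?rep1 //.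
exact: subgroupV.
Qed.

Lemma rep_coset x y : W x -> W y -> K (x^-1 * y) -> rho x = rho y.
Proof.
move=> Wx Wy /rhoK; rewrite rhoM ?repV //; last exact: subgroupV.
move=> h; have /h/(canRL (mulVKg _)) -> : W (x^-1 * y).
  by apply: subgroupM => //; exact: subgroupV.
by rewrite mulg1.
Qed.

(** Modulo the open subgroup K, an element of the closure agrees with an integer power of x. *)
Lemma rep_cyc x y : W x -> closure (cyc x) `<=` W -> closure (cyc x) y ->
  rho y \in <[rho x]>.
Proof.
move=> Wx sub xy; have [c cx Kc] := closure_coset oK xy.
rewrite (rep_coset (sub _ xy) (sub _ (subset_closure cx)) Kc).
have [[n|n] _ <-] := cx; rewrite /gpowz gpownE; first by rewrite repX ?mem_cycle.
by rewrite repV ?groupV ?repX ?mem_cycle //; exact: subgroupX.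
Qed.

Lemma rep_order pi x m : W x -> pi.-nat m -> K (x ^+ m) -> pi.-nat #[rho x].
Proof.
move=> Wx pm Km; apply: pnat_dvd pm; rewrite order_dvdn -repX //.
by apply/eqP/rhoK => //; exact: subgroupX.
Qed.

End Rep.

(* The product of two procyclic pi-groups is a compact group all of whose finite quotients are
   products of two cyclic pi-groups. *)
Lemma pieltM pi x y : pielt pi x -> pielt pi y -> pielt pi (x * y).
Proof.
move=> px py U oU.
set X := closure (cyc x); set Y := closure (cyc y).
have sX : subgroup X by exact: closure_cyc_subgroup.
have sY : subgroup Y by exact: closure_cyc_subgroup.
have cX : compact X by exact: closure_cyc_compact.
have cY : compact Y by exact: closure_cyc_compact.
have XY : setmul X Y = setmul Y X by exact: compact_setmulC.
have sW : subgroup (setmul X Y) by exact: setmul_subgroup.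
have [T [rho [K [oK KU rhoM rhoK]]]] := finite_quotient (setmul_compact cX cY) sW oU.
have XW : X `<=` setmul X Y by move=> z; exact: setmulEl.
have YW : Y `<=` setmul X Y by move=> z; exact: setmulEr.
have Xx : X x by exact: closure_cyc_id.
have Yy : Y y by exact: closure_cyc_id.
have Wx := XW _ Xx; have Wy := YW _ Yy.
have rX z : X z -> rho z \in <[rho x]>.
  exact: (rep_cyc sW oK rhoM rhoK Wx XW).
have rY z : Y z -> rho z \in <[rho y]>.
  exact: (rep_cyc sW oK rhoM rhoK Wy YW).
have rX' u : u \in <[rho x]> -> exists2 z, X z & u = rho z.
  case/cycleP => n ->; exists (x ^+ n); first exact: (subgroupX sX).
  by rewrite (repX sW oK rhoM rhoK).
have rY' u : u \in <[rho y]> -> exists2 z, Y z & u = rho z.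
  case/cycleP => n ->; exists (y ^+ n); first exact: (subgroupX sY).
  by rewrite (repX sW oK rhoM rhoK).
have com : commute (<[rho x]> : {set {perm T}}) (<[rho y]> : {set {perm T}}).
  apply/setP => u; apply/mulsgP/mulsgP => -[a b].
    move=> /rX' [z Xz ->] /rY' [t Yt ->] ->.
    have : setmul X Y (z * t) by exists z, t.
    rewrite XY => -[t' [z' [Yt' [Xz' e]]]].
    exists (rho t') (rho z'); [exact: rY|exact: rX|].
    by rewrite -!rhoM; [congr rho|exact: YW|exact: XW|exact: XW|exact: YW].
  move=> /rY' [t Yt ->] /rX' [z Xz ->] ->.
  have : setmul Y X (t * z) by exists t, z.
  rewrite -XY => -[z' [t' [Xz' [Yt' e]]]].
  exists (rho z') (rho t'); [exact: rX|exact: rY|].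
  by rewrite -!rhoM; [congr rho|exact: XW|exact: YW|exact: YW|exact: XW].
have [m [pm Km]] := px K oK; have [n [pn Kn]] := py K oK.
have ox := rep_order sW oK rhoM rhoK Wx pm Km.
have oy := rep_order sW oK rhoM rhoK Wy pn Kn.
(* The two cyclic groups commute as sets, so their join is their product set, whose size divides the
   product of the two orders. *)
have card : pi.-nat #|<[rho x]> <*> <[rho y]>|.
  rewrite (comm_joingE com); apply: (@pnat_dvd _ (#[rho x] * #[rho y])).
    by rewrite mul_cardG dvdn_mulr.
  by rewrite pnatM ox.
exists #[rho (x * y)]; split.
  apply: pnat_dvd card; apply: order_dvdG.
  by rewrite rhoM // groupM // mem_gen // inE cycle_id ?orbT.
apply: KU; apply/rhoK; first by apply: subgroupX => //; exact: subgroupM.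
rewrite (repX sW oK rhoM rhoK) ?expg_order //; exact: subgroupM.
Qed.

Lemma pielt_subgroup pi : subgroup [set x | pielt pi x].
Proof. by split; [exact: pielt1|exact: pieltM|exact: pieltV]. Qed.

(* Every x lies in the compact open subgroup cl<x>U, which has enough finite quotients. *)
Lemma pielt_closed pi : closed [set x | pielt pi x].
Proof.
move=> x clx U oU.
have [U0 [oU0 cU0 _]] := opensub_base (@filterT _ _ (nbhs_filter (1 : G))).
set X := closure (cyc x).
have sX : subgroup X by exact: closure_cyc_subgroup.
have cX : compact X by exact: closure_cyc_compact.
have sW : subgroup (setmul X U0).
  by apply: setmul_subgroup => //; [exact: oU0.2|apply: compact_setmulC => //; exact: oU0.2].
have [T [rho [K [oK KU rhoM rhoK]]]] := finite_quotient (setmul_compact cX cU0) sW oU.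
have Wx : setmul X U0 x by apply: setmulEl; [exact: oU0.2|exact: closure_cyc_id].
(* A pi-element y this close to x lies in the same compact group and has the same image under [rho],
   so an exponent for y modulo K serves x. *)
have [y py [Ky Uy]] := closure_coset (opensubI oK oU0) clx.
have Wy : setmul X U0 y.
  by rewrite -(mulVKg x y); apply: subgroupM => //; exact: setmulEr.
have e : rho x = rho y by exact: (rep_coset sW oK rhoM rhoK).
have [m [pm Km]] := py K oK; exists m; split => //.
apply: KU; apply/rhoK; first exact: subgroupX.
rewrite (repX sW oK rhoM rhoK) // e -(repX sW oK rhoM rhoK) //.
by apply/rhoK => //; exact: subgroupX.
Qed.

End PeriodicGroup.

(** * Exponents that isolate the p-part, and orders modulo a subgroup *)

Lemma primary_exponents (p : nat) : prime p -> exists e : nat -> nat,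
  (forall n, 0 < e n)%N /\
  forall a r, (p^')%N.-nat r ->
    \forall n \near \oo, (p ^ a %| (e n).-1)%N /\ (r %| e n)%N.
Proof.
(* The p'-part of n! is divisible by every p'-number up to n. *)
move=> pp; pose r n := (n`!`_p^')%N.
have co n : coprime (p ^ n) (r n).
  by apply: (@pnat_coprime p); [rewrite pnatX pnat_id | exact: part_pnat].
have r0 n : (0 < p ^ n * r n)%N by rewrite muln_gt0 expn_gt0 prime_gt0 // part_gt0.
(* By the Chinese remainder theorem e n is 1 modulo p^n and 0 modulo r n; the extra summand makes it
   positive, so that its predecessor is e n - 1. *)
pose e n := (chinese (p ^ n) (r n) 1 0 + p ^ n * r n)%N.
have e0 n : (0 < e n)%N by rewrite addn_gt0 r0 orbT.
exists e; split=> // a s ps; exists (maxn a s) => // n /=.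
rewrite geq_max => /andP [an sn]; split.
  rewrite -subn1; apply: dvdn_trans (dvdn_exp2l p an) _.
  rewrite -eqn_mod_dvd ?e0 // /e addnC mulnC modnMDl.
  by apply/eqP; exact: chinese_modl.
have s0 : (0 < s)%N by case/andP: ps.
have sr : (s %| r n)%N.
  by rewrite -(part_pnat_id ps) partn_dvd ?fact_gt0 // dvdn_fact // s0.
apply: dvdn_trans sr _; rewrite /e dvdn_addl ?dvdn_mull //.
by rewrite /dvdn (chinese_modr (co n)) mod0n.
Qed.

Section OrderModSubgroup.
Variables (G : tgroup) (S : set G) (x : G).
Hypothesis sS : subgroup S.

(** The least positive exponent works, by division with remainder; it serves as the order of x
    modulo S. *)
Lemma order_mod_subgroup : (exists2 m, (0 < m)%N & S (x ^+ m)) ->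
  exists m, [/\ (0 < m)%N, S (x ^+ m) & forall n, S (x ^+ n) -> (m %| n)%N].
Proof.
move=> [m0 m0_gt0 Sm0].
have ex : exists m, (0 < m)%N && `[< S (x ^+ m) >].
  by exists m0; rewrite m0_gt0; apply/asboolP.
case: (ex_minnP ex) => m /andP [m_gt0 /asboolP Sm] mmin.
exists m; split => // n Sn; apply: contraT; rewrite /dvdn -lt0n => nm.
have := mmin (n %% m)%N; rewrite nm /= leqNgt ltn_pmod // => /implyP.
rewrite implybF => /negP; case; apply/asboolP.
apply: (@subgroupMl _ S sS (x ^+ (n %/ m * m))); last by rewrite -expgnDr -divn_eq.
by rewrite mulnC expgnA; exact: subgroupX.
Qed.

End OrderModSubgroup.

(** * The p-part of an element as a continuous endomorphism *)

Section PrimaryComponents.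
Variable G : tgroup.
Implicit Types (x y z g h : G) (S U V W X Y : set G) (p q : nat) (pi : nat_pred).
Hypothesis perG : periodic_on [set: G].

(** The compact group cl<g> has a finite quotient whose kernel lies in U; m is the order of the
    image of g. *)
Lemma periodic_torsion U g : opensub U -> exists2 m, (0 < m)%N & U (g ^+ m).
Proof.
move=> oU; set W := closure (cyc g).
have sW : subgroup W by exact: closure_cyc_subgroup.
have [T [rho [K [oK KU rhoM rhoK]]]] :=
  finite_quotient (@closure_cyc_compact G perG g) sW oU.
exists #[rho g]; first exact: order_gt0.
have Wg : W g by exact: closure_cyc_id.
apply: KU; apply/rhoK; first exact: (subgroupX sW).
by rewrite (repX sW oK rhoM rhoK) // expg_order.
Qed.

(** The commutator of x and g lies in every open subgroup, because x is arbitrarily close to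
    elements c of <g>, which commute with g. *)
Lemma closure_cyc_commute g x : closure (cyc g) x -> commute g x.
Proof.
move=> gx; suff : x^-1 * x ^ g = 1.
  by move=> /mulg1_eq; rewrite invgK => e; rewrite /commute {1}e conjgE mulVKg.
apply: (opensub_sep perG) => U oU.
have [c cc [Uc Ucg]] := closure_coset (opensubI oU (opensubJ g oU)) gx.
have e : x = c * (x^-1 * c)^-1 by rewrite invgM invgK mulVKg.
have cg : c ^ g = c by rewrite conjgE -(cyc_commute cc) mulKg.
rewrite {2}e conjMg cg conjVg mulgA; apply: subgroupM => //; first exact: oU.2.
by apply: subgroupV => //; exact: oU.2.
Qed.

Lemma component_exists p g : prime p ->
  exists h, [/\ closure (cyc g) h, pielt p h & pielt (p^')%N (h^-1 * g)].
Proof.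
move=> pp; have [e [e_gt0 eP]] := primary_exponents pp.
pose u n := g ^+ e n.
have [|h [gh hcl]] := @closure_cyc_compact G perG g (u @ \oo) _.
  by exists 0%N => // n _; apply: subset_closure; exact: cyc_pow.
have com : commute g h by exact: closure_cyc_commute.
suff key U : opensub U -> exists a r, [/\ (p^')%N.-nat r, U (h ^+ (p ^ a)) &
    U ((h^-1 * g) ^+ r)].
  exists h; split => // U /key [a [r [pr Uh Uk]]]; last by exists r.
  by exists (p ^ a)%N; rewrite pnatX pnat_id.
move=> oU; have sU := oU.2.
have [m m_gt0 Um] := periodic_torsion g oU.
(* Here m = p^a r kills g modulo U; it will turn out that p^a kills h and r kills h^-1 g. *)
pose a := logn p m; pose r := (m`_p^')%N.
have mE : m = (p ^ a * r)%N by rewrite -p_part partnC.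
have pr : (p^')%N.-nat r by exact: part_pnat.
exists a, r; split => //.
all: have [A [N _ AN] hA] : exists2 A : set nat, \oo A &
    forall n, A n -> (p ^ a %| (e n).-1)%N /\ (r %| e n)%N
  by exists [set n | (p ^ a %| (e n).-1)%N /\ (r %| e n)%N]; first exact: eP.
(* As h is a cluster point, some n with both divisibilities also has u n in the coset hU. *)
all: have [|_ [[n An <-] /= Un]] := hcl (u @` A) _ _ (nbhs_coset h (opensub_nbhs oU));
  first by exists N => // n /AN An; exists n.
all: have [/dvdnP [t et] /dvdnP [s es]] := hA n An.
all: have comu : commute h (u n) by exact/commuteX/commute_sym.
all: rewrite -[u n]/(g ^+ e n) in Un comu.
(* Since r divides e n, m divides e n p^a, and so u n ^ p^a lies in U. *)
- have := subgroupX sU (p ^ a) Un.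
  rewrite expgMn; last exact/commute_sym/commuteV/commute_sym.
  rewrite -expgnA es -mulnA (mulnC r) -mE mulnC expgnA => h1.
  by apply: subgroupVE => //; rewrite -expVgn; apply: subgroupMr h1 => //; exact: subgroupX.
(* Now h^-1 u n is h^-1 g times a power of g^(p^a), and the r-th power of the latter factor lies in
   U. *)
- have eE : e n = (1 + t * p ^ a)%N by rewrite -et add1n prednK.
  have com1 : commute h^-1 g by exact/commute_sym/commuteV.
  have := subgroupX sU r Un; rewrite eE expgnDr expg1 mulgA expgMn; last first.
    by apply/commuteX; apply/commute_sym/commuteM; [exact: commute_sym|exact: commute_refl].
  rewrite -expgnA -mulnA -mE mulnC expgnA => h2.
  apply: subgroupMr h2 => //.
  exact: (subgroupX sU).
Qed.

Hypothesis tqhG : tqh_on [set: G].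

Lemma pielt_cvg p x : prime p ->
  pielt p x <-> (fun n => gpown x (p ^ n)) @ \oo --> tg_one G.
Proof.
move=> pp; have -> : (fun n => gpown x (p ^ n)) = (fun n => x ^+ (p ^ n)).
  by apply/funext => n; rewrite gpownE.
rewrite (cvg_pow1 perG); split=> [px U oU|h U oU].
  have [m [/p_natP [k ->] Um]] := px U oU.
  exists k => // n /= kn; apply: subgroup_expg_dvd Um _; first exact: oU.2.
  exact: dvdn_exp2l.
have [N _ /(_ N (leqnn N)) UN] := h U oU.
by exists (p ^ N)%N; rewrite pnatX pnat_id.
Qed.

(** If a prime q other than p divides the order of g modulo U, then g is no q'-element, so its
    q-component is nontrivial. Conversely, cl<g> consists of p-elements when g is one, and these
    meet the q-elements trivially. *)
Lemma p_eltP p g : prime p -> p_elt_on [set: G] p g <-> pielt p g.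
Proof.
move=> pp; split=> [h U oU|pg q pq qp].
  have sU := oU.2; have [m [m0 Um mmin]] := order_mod_subgroup sU (periodic_torsion g oU).
  exists m; split => //; apply/pnatP => // q pq qm.
  apply: contraT => /eqP qp; have [k [gk qk qk']] := component_exists g pq.
  have : primary_comp [set: G] q g k.
    by split; [split | apply/pielt_cvg].
  rewrite (h q pq qp) => /= k1.
  have [n [qn Un]] := qk' U oU; move: Un; rewrite k1 -[tg_one G]/(1 : G) invg1 mul1g.
  move=> /mmin mn; have := pnat_dvd (dvdn_trans qm mn) qn.
  by rewrite pnatE // inE /= inE eqxx.
apply/seteqP; split=> z.
  move=> [[gz _] /pielt_cvg -/(_ pq) qz]; apply: (pielt_disjoint perG qz).
  apply: (@pielt_sub _ p); first by move=> r; rewrite !inE => /eqP ->; apply/eqP => /esym.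
  by apply: (closure_cyc_sub _ _ pg gz); [exact: pielt_closed|exact: pielt_subgroup].
move=> ->; split; first by split => //; exact: subgroup1 (closure_cyc_subgroup _).
by apply/pielt_cvg => //; exact: pielt1.
Qed.

(** For prime [p] such an h exists by [component_exists], so the default 1 is never reached;
    [ppart_uniq] makes the choice canonical. *)
Definition ppart p x : G :=
  xget 1 [set h | [/\ closure (cyc x) h, pielt p h & pielt (p^')%N (h^-1 * x)]].

Section Component.
Variable p : nat.
Hypothesis pp : prime p.

Lemma ppartP x :
  [/\ closure (cyc x) (ppart p x), pielt p (ppart p x) & pielt (p^')%N ((ppart p x)^-1 * x)].
Proof.
rewrite /ppart; case: xgetP => [h -> //|].
by have [h hP] := component_exists x pp; move=> /(_ h).
Qed.

(** The quotient of two candidates is both a p-element and a p'-element. *)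
Lemma ppart_uniq x h : pielt p h -> pielt (p^')%N (h^-1 * x) -> ppart p x = h.
Proof.
move=> ph ph'; have [_ pc pc'] := ppartP x.
suff e : h^-1 * ppart p x = 1 by rewrite -(mulVKg h (ppart p x)) e mulg1.
apply: (pielt_disjoint perG (pi := p)).
  by apply: (pieltM perG tqhG) => //; exact: pieltV.
have -> : h^-1 * ppart p x = (h^-1 * x) * ((ppart p x)^-1 * x)^-1.
  by rewrite invgM invgK mulgA mulgK.
by apply: (pieltM perG tqhG) => //; exact: pieltV.
Qed.

(** The complementary factor of xy is a conjugate of that of x times that of y, and p'-elements form
    a normal subgroup. *)
Lemma ppartM x y : ppart p (x * y) = ppart p x * ppart p y.
Proof.
have [_ px px'] := ppartP x; have [_ py py'] := ppartP y.
apply: ppart_uniq; first exact: (pieltM perG tqhG).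
have -> : (ppart p x * ppart p y)^-1 * (x * y) =
    ((ppart p x)^-1 * x) ^ ppart p y * ((ppart p y)^-1 * y).
  by rewrite conjgE invgM -!mulgA mulVKg.
by apply: (pieltM perG tqhG) => //; exact: pieltJ.
Qed.

Lemma ppart_id x : pielt p x -> ppart p x = x.
Proof. by move=> px; apply: ppart_uniq => //; rewrite mulVg; exact: pielt1. Qed.

Lemma ppart_trivial x : pielt (p^')%N x -> ppart p x = 1.
Proof. by move=> px; apply: ppart_uniq; [exact: pielt1|rewrite invg1 mul1g]. Qed.

Lemma ppart1 : ppart p 1 = 1.
Proof. by apply: ppart_id; exact: pielt1. Qed.

Lemma ppartX x n : ppart p (x ^+ n) = ppart p x ^+ n.
Proof. by elim: n => [|n ih]; [rewrite !expg0 ppart1|rewrite !expgS ppartM ih]. Qed.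

Lemma ppart_opensub U x : opensub U -> U x -> U (ppart p x).
Proof.
move=> oU Ux; have [cx _ _] := ppartP x.
by apply: (closure_cyc_sub (opensub_closed oU) oU.2 Ux cx).
Qed.

(** A homomorphism that maps every open subgroup into itself is continuous. *)
Lemma ppart_continuous : continuous (ppart p).
Proof.
move=> x S Sx; have [U [oU _ US]] := opensub_base perG (nbhs_mull1 Sx).
apply: filterS (nbhs_coset x (opensub_nbhs oU)) => y /= Uy.
rewrite -(mulVKg x y) ppartM; apply: US; exact: ppart_opensub.
Qed.

Lemma ppart_opensub_coprime U x m : opensub U -> coprime p m -> U (x ^+ m) ->
  U (ppart p x).
Proof.
move=> oU pm Um; have [_ px _] := ppartP x.
have [n [/p_natP [k ->] Un]] := px U oU.
have Um' : U (ppart p x ^+ m) by rewrite -ppartX; exact: ppart_opensub.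
by apply: (subgroup_expg_coprime oU.2 Un Um'); exact: coprimeXl.
Qed.

End Component.

(** Suppose a prime q divides the order m of x modulo U. The q-part of x lies in U and a q'-number r
    kills the rest, so x^r is in U and q divides r, a contradiction. *)
Lemma opensub_pparts U x : opensub U ->
  (forall p, prime p -> U (ppart p x)) -> U x.
Proof.
move=> oU h; have sU := oU.2.
have [m [m0 Um mmin]] := order_mod_subgroup sU (periodic_torsion x oU).
case: (eqVneq m 1%N) => [m1|m1]; first by move: Um; rewrite m1 expg1.
have pp : prime (pdiv m) by apply: pdiv_prime; case: m {Um mmin} m0 m1 => [|[]].
have [cx _ /(_ U oU) [r [pr Ur]]] := ppartP pp x.
have com : commute (ppart (pdiv m) x) ((ppart (pdiv m) x)^-1 * x).
  apply: commuteM; first exact/commuteV/commute_refl.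
  by apply/commute_sym/closure_cyc_commute.
have : U (x ^+ r).
  rewrite -(mulVKg (ppart (pdiv m) x) x) expgMn //; apply: subgroupM => //.
  by apply: subgroupX => //; exact: h.
move=> /mmin mr; have := pnat_dvd (dvdn_trans (pdiv_dvd m) mr) pr.
by rewrite pnatE // inE /= inE eqxx.
Qed.

(** A prime larger than an exponent m with x^m in U is coprime to m. *)
Lemma pparts_almost_all U x : opensub U ->
  exists N, forall p, prime p -> (N <= p)%N -> U (ppart p x).
Proof.
move=> oU; have [m m0 Um] := periodic_torsion x oU.
exists m.+1 => p pp mp; apply: ppart_opensub_coprime oU _ Um => //.
by rewrite prime_coprime // gtnNdvd.
Qed.

End PrimaryComponents.

(** * Decomposition of G into a local product *)

Lemma sig_val_inj (sigma : set nat) (i j : {p | sigma p}) :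
  proj1_sig i = proj1_sig j -> i = j.
Proof. by case: i j => [p a] [q b] /= e; subst q; congr exist; exact: Prop_irrelevance. Qed.

Lemma finite_set_bounded (sigma : set nat) (A : set {p | sigma p}) :
  finite_set A <-> exists N, forall j, A j -> (proj1_sig j < N)%N.
Proof.
split=> [/(finite_image (@proj1_sig _ _)) /finite_seqP [s sE]|[N h]].
  exists (\max_(i <- s) i).+1 => j Aj; rewrite ltnS.
  have : [set` s] (proj1_sig j) by rewrite -sE; exists j.
  by move=> /= js; exact: leq_bigmax_seq.
apply: (@sub_finite_set _ _ (@proj1_sig _ _ @^-1` `I_N)); first exact: h.
by apply: finite_preimage => [i j _ _|]; [exact: sig_val_inj|exact: finite_II].
Qed.

Lemma prod_topology_cvg (I : Type) (K : I -> topologicalType)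
    (F : set_system (prod_topology K)) (t : prod_topology K) : Filter F ->
  (forall i, (fun f : prod_topology K => f i) @ F --> t i) -> F --> t.
Proof.
move=> FF h; apply/cvg_sup => i U [B [[W oW <-] Wt] BU].
by apply: filterS BU _; apply: h; exact: open_nbhs_nbhs.
Qed.

Section Decomposition.
Variable G : tgroup.
Implicit Types (x y z g h : G) (S U V W X Y : set G) (p q : nat).
Hypotheses (perG : periodic_on [set: G]) (tqhG : tqh_on [set: G]).

Lemma p_eltsE p : prime p -> p_elts G p = [set x | pielt p x].
Proof. by move=> pp; apply/seteqP; split => x /(p_eltP perG tqhG) -/(_ pp). Qed.

Lemma p_elts_closed p : prime p -> closed (p_elts G p).
Proof. by move=> pp; rewrite p_eltsE //; exact: pielt_closed. Qed.

Lemma p_elts_subgroup p : prime p -> subgroup (p_elts G p).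
Proof. by move=> pp; rewrite p_eltsE //; exact: pielt_subgroup. Qed.

Lemma periodic_closed_subgroup S : closed S -> subgroup S -> periodic_on S.
Proof.
move=> cS sS; case: perG => _ hG lcG tdG pG; split => //.
- by move=> x y _ _; exact: hG.
- move=> x Sx; have [K [cK _ [O [oO Ox OK]]]] := lcG x I.
  exists (K `&` S); split; [exact: compact_closedI | by move=> y [] |].
  by exists O; split => // y [Oy Sy]; split => //; apply: OK.
- move=> x Sx; apply/seteqP; split => [y|y ->]; last exact: connected_component_refl.
  move=> [A [Ax AS cA] Ay]; rewrite -(tdG x I); exists A => //.
- by move=> g Sg; apply: compact_closedI => //; exact: closure_cyc_compact.
Qed.

Lemma tqh_closed S : closed S -> tqh_on S.
Proof.
move=> cS X Y XS YS sX sY cX cY.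
have clT Z : Z `<=` S -> closed_in S Z -> closed_in [set: G] Z.
  move=> ZS cZ z [zZ _]; apply: cZ; split => //; exact: closed_sub_closure zZ.
have := tqhG (@subsetT _ X) (@subsetT _ Y) sX sY (clT X XS cX) (clT Y YS cY).
by rewrite !setIT => ->.
Qed.

Lemma p_elts_lc_pgroup p : prime p -> lc_pgroup_on (p_elts G p) p.
Proof.
move=> pp; split.
  by apply: periodic_closed_subgroup; [exact: p_elts_closed|exact: p_elts_subgroup].
move=> g pg q pq qp; have := pg q pq qp => e; apply/seteqP; split => z.
  move=> [[gz _] cz]; have : primary_comp [set: G] q g z by [].
  by rewrite e.
move=> ->; have : primary_comp [set: G] q g (tg_one G) by rewrite e.
by move=> [[g1 _] c1]; split=> //; split => //; exact: subgroup1 (p_elts_subgroup pp).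
Qed.

Lemma ppartV p x : prime p -> ppart p x^-1 = (ppart p x)^-1.
Proof. by move=> pp; apply/esym/mulg1_eq; rewrite -ppartM // mulgV ppart1. Qed.

Lemma ppart_prime_set p x : prime p -> ~ prime_set G p -> ppart p x = 1.
Proof.
move=> pp np; apply: contrapT => c1; apply: np; split => //.
by exists (ppart p x); split => //; apply/(p_eltP perG tqhG) => //; case: (ppartP perG pp x).
Qed.

Section PartialProducts.
Variable t : nat -> G.
Hypothesis pt : forall p, prime p -> pielt p (t p).

Fixpoint partial_prod n : G :=
  if n is m.+1 then partial_prod m * (if prime m then t m else 1) else 1.

Lemma ppart_partial_prod q n : prime q ->
  ppart q (partial_prod n) = if (q < n)%N then t q else 1.
Proof.
move=> pq; elim: n => [|n ih] /=; first exact: ppart1.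
rewrite ppartM // ih ltnS; case pn: (prime n).
  case: (ltngtP q n) => [qn|nq|<-].
  - rewrite (@ppart_trivial _ perG tqhG _ pq (t n)) ?mulg1 //.
    apply: pielt_sub (pt pn) => r; rewrite !inE => /eqP ->.
    by rewrite neq_ltn qn orbT.
  - rewrite (@ppart_trivial _ perG tqhG _ pq (t n)) ?mulg1 //.
    apply: pielt_sub (pt pn) => r; rewrite !inE => /eqP ->.
    by rewrite neq_ltn nq.
  - by rewrite mul1g ppart_id //; exact: pt.
rewrite ppart1 // mulg1; case: (ltngtP q n) => // e.
by rewrite -e pq in pn.
Qed.

(** From N on, the partial products stay in one compact coset of U. For n > p their p-part is t p,
    which passes to a cluster point. *)
Lemma partial_prod_limit U N : compact U -> opensub U ->
  (forall p, prime p -> (N <= p)%N -> U (t p)) ->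
  exists x, forall p, prime p -> ppart p x = t p.
Proof.
move=> cU oU Ut; pose A := [set partial_prod N * u | u in U].
have cA : compact A.
  apply: continuous_compact cU; apply: continuous_subspaceT; exact: mull_continuous.
have As n : (N <= n)%N -> A (partial_prod n).
  elim: n => [|n ih].
    by rewrite leqn0 => /eqP N0; exists 1; [exact: subgroup1 oU.2|rewrite mulg1 N0].
  rewrite leq_eqVlt => /predU1P[e|Nn].
    by exists 1; [exact: subgroup1 oU.2|rewrite mulg1 e].
  have [u Uu e] := ih Nn; exists (u * (if prime n then t n else 1)); last first.
    by rewrite /= -e mulgA.
  apply: subgroupM => //; first exact: oU.2.
  by case: ifP => pn; [exact: Ut|exact: subgroup1 oU.2].
have [|x [_ xc]] := cA (partial_prod @ \oo) _; first by exists N => // n; exact: As.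
exists x => p pp; suff e : (ppart p x)^-1 * t p = 1.
  by rewrite -(mulVKg (ppart p x) (t p)) e mulg1.
apply: (opensub_sep perG) => V oV.
have [|_ [[n /= pn <-] Vn]] :=
  xc (partial_prod @` [set n | (p < n)%N]) _ _ (nbhs_coset x (opensub_nbhs oV)).
  by exists p.+1 => // n /= pn; exists n.
have := ppart_opensub perG pp oV Vn.
by rewrite ppartM // ppartV // ppart_partial_prod // pn.
Qed.

End PartialProducts.

Lemma prime_set_prime (j : {p : nat | prime_set G p}) : prime (proj1_sig j).
Proof. by case: j => p []. Qed.

Lemma localprod_decomposition : exists U : nat -> set G,
  (forall p, prime_set G p ->
    [/\ U p `<=` p_elts G p, subgroup (U p), compact (U p) &
        rel_open_in (p_elts G p) (U p)]) /\
  localprod_iso G {p : nat | prime_set G p} (fun=> G)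
    (fun j => p_elts G (proj1_sig j)) (fun j => U (proj1_sig j)).
Proof.
have [U0 [oU0 cU0 _]] := opensub_base perG (@filterT _ _ (nbhs_filter (1 : G))).
exists (fun p => U0 `&` p_elts G p); split.
  move=> p [pp _]; split.
  - by move=> x [].
  - by apply: subgroupI; [exact: oU0.2|exact: p_elts_subgroup].
  - by apply: compact_closedI => //; exact: p_elts_closed.
  - by exists U0; split => //; exact: oU0.1.
pose phi (x : G) : prod_topology (fun _ : {p : nat | prime_set G p} => (G : topologicalType)) :=
  fun j => ppart (proj1_sig j) x.
have phi_in x j : p_elts G (proj1_sig j) (phi x j).
  by rewrite p_eltsE; [case: (ppartP perG (prime_set_prime j) x)|exact: prime_set_prime].
(* Thus the preimage of the product of the U p is U0, a compact open set. *)
have in_U0 x : U0 x <-> forall j, (U0 `&` p_elts G (proj1_sig j)) (phi x j).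
  split=> [Ux j|h].
    by split => //; apply: ppart_opensub => //; exact: prime_set_prime.
  apply: (opensub_pparts perG oU0) => p pp.
  have [pG|npG] := pselect (prime_set G p); first by case: (h (exist _ p pG)).
  by rewrite ppart_prime_set //; exact: subgroup1 oU0.2.
have phi_cont : continuous phi.
  move=> x; apply: prod_topology_cvg => j.
  exact: (ppart_continuous perG tqhG (prime_set_prime j)).
have phi_inj : injective phi.
  move=> x y e; suff : x^-1 * y = 1 by move=> /mulg1_eq; rewrite invgK.
  apply: (opensub_sep perG) => U oU; apply: (opensub_pparts perG oU) => p pp.
  have [pG|npG] := pselect (prime_set G p); last first.
    by rewrite ppart_prime_set //; exact: subgroup1 oU.2.
  have : phi x (exist _ p pG) = phi y (exist _ p pG) by rewrite e.
  rewrite /phi /= => exy; rewrite ppartM // ppartV // exy mulVg.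
  exact: subgroup1 oU.2.
have phi_im t : (exists x, phi x = t) <->
    (forall j, p_elts G (proj1_sig j) (t j)) /\
    finite_set [set j | ~ (U0 `&` p_elts G (proj1_sig j)) (t j)].
  split=> [[x <-]|[tS /finite_set_bounded [N tN]]].
    split; first exact: phi_in.
    apply/finite_set_bounded; have [N UN] := pparts_almost_all perG tqhG x oU0.
    exists N => j; apply: contra_notT; rewrite -leqNgt => Nj.
    by split; [exact: UN (prime_set_prime j) Nj|exact: phi_in].
  (* Extends t by 1 to all natural numbers, so that partial products can be indexed by [nat]. *)
  pose t' p := if pselect (prime_set G p) is left h then t (exist _ p h) else 1.
  have t'E p (h : prime_set G p) : t' p = t (exist _ p h).
    by rewrite /t'; case: pselect => // h'; congr t; exact: sig_val_inj.
  have pt' p : prime p -> pielt p (t' p).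
    move=> pp; rewrite /t'; case: pselect => [h|_]; last exact: pielt1.
    by have := tS (exist _ p h); rewrite p_eltsE.
  have Ut' p : prime p -> (N <= p)%N -> U0 (t' p).
    move=> pp Np; rewrite /t'; case: pselect => [h|_]; last exact: subgroup1 oU0.2.
    apply: contrapT => nU; have /tN : ~ (U0 `&` p_elts G p) (t (exist _ p h)) by case.
    by rewrite /= ltnNge Np.
  have [x xt] := partial_prod_limit pt' cU0 oU0 Ut'.
  exists x; apply: functional_extensionality_dep => -[p h].
  by rewrite /phi xt ?t'E //=; case: (h).
exists phi; split => //.
- move=> x y; apply/funext => j; exact: (ppartM perG tqhG (prime_set_prime j)).
- rewrite [X in open X](_ : _ = U0); first exact: oU0.1.
  by apply/seteqP; split => x /in_U0.
- move=> W WP; split=> [oW|[O [oO WE]]]; last first.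
    have -> : W = phi @^-1` O `&` U0.
      apply/seteqP; split => x.
        move=> Wx; have : (phi @` W) (phi x) by exists x.
        by rewrite WE => -[Ox Px]; split => //; apply/in_U0.
      move=> [Ox /in_U0 Px]; have : (phi @` W) (phi x) by rewrite WE.
      by move=> [y Wy /phi_inj <-].
    apply: openI; last exact: oU0.1.
    by apply: (continuousP _).1 oO.
  (* A continuous injection of a compact space into a Hausdorff space is an embedding: the image of
     the compact complement of W in U0 is closed. *)
  have cR : compact (phi @` (U0 `\` W)).
    apply: continuous_compact; first exact: continuous_subspaceT.
    by apply: compact_closedI => //; rewrite closedC.
  exists (~` (phi @` (U0 `\` W))); split.
    rewrite openC; apply: (compact_closed _ cR).
    exact: (@hausdorff_product {classic {p : nat | prime_set G p}} (fun=> G)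
      (fun=> periodic_hausdorff perG)).
  apply/seteqP; split => [_ [x Wx <-]|t [nt Pt]].
    split; last exact: WP.
    by move=> [y [_ nWy] /phi_inj e]; apply: nWy; rewrite e.
  have [x xt] : exists x, phi x = t.
    apply/phi_im; split=> [j|]; first by case: (Pt j).
    by apply/finite_set_bounded; exists 0%N => j /(_ (Pt j)).
  exists x => //; apply: contrapT => nWx; apply: nt; exists x => //; split => //.
  by apply/in_U0 => j; rewrite xt.
Qed.

End Decomposition.

(** * Local products of topologically quasihamiltonian p-groups *)

Lemma near_below (M : nat) (Q : nat -> nat -> Prop) :
  (forall i, (i < M)%N -> \forall n \near \oo, Q i n) ->
  \forall n \near \oo, forall i, (i < M)%N -> Q i n.
Proof.
elim: M => [_|M ih h]; first by exists 0%N.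
have h1 := ih (fun i iM => h i (leqW iM)); have h2 := h M (leqnn _).
apply: filterS (filterI h1 h2) => n [q1 q2] i; rewrite ltnS leq_eqVlt.
by move=> /predU1P[->|/q1].
Qed.

Section ProductBasis.
Variables (sigma : set nat) (K : {p : nat | sigma p} -> topologicalType).

(** The boxes around t constraining only coordinates below some N generate a filter that converges
    to t in each coordinate, hence in the product. *)
Lemma prod_topology_basis (t : prod_topology K) (O : set (prod_topology K)) :
  nbhs t O -> exists (N : nat) (V : forall j, set (K j)),
    (forall j, nbhs (t j) (V j)) /\
    forall t' : prod_topology K,
      (forall j, (proj1_sig j < N)%N -> V j (t' j)) -> O t'.
Proof.
pose D := [set NV : nat * (forall j, set (K j)) | forall j, nbhs (t j) (NV.2 j)].
pose B (NV : nat * (forall j, set (K j))) : set (prod_topology K) :=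
  [set t' | forall j, (proj1_sig j < NV.1)%N -> NV.2 j (t' j)].
have FF : Filter (filter_from D B).
  apply: filter_from_filter.
    by exists (0%N, fun j => setT) => j; exact: filterT.
  move=> [M V] [N W] DV DW; exists (maxn M N, fun j => V j `&` W j).
    by move=> j; apply: filterI; [exact: DV|exact: DW].
  by move=> t' h; split => j jN; have [] := h j _; rewrite /= ?leq_max ?jN ?orbT.
have cv : filter_from D B --> t.
  apply: prod_topology_cvg => i S iS.
  (* The transport along e imposes S at the coordinate i and nothing at any other. *)
  exists ((proj1_sig i).+1, fun j => [set y | forall e : j = i, S (eq_rect j K y i e)]).
    move=> j /=; have [e|ne] := pselect (j = i).
      subst j; apply: filterS iS => y Sy e.
      by rewrite (Prop_irrelevance e erefl).
    by apply: filterS (@filterT _ _ (nbhs_filter (t j))) => y _ e.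
  by move=> t' /(_ i (leqnn _) erefl).
by move=> /cv [[N V] DV BV]; exists N, V; split => // t' h; exact: BV.
Qed.

End ProductBasis.

Section LocalProduct.
Variables (sigma : set nat) (Gp : {p : nat | sigma p} -> tgroup).
Hypothesis sigmaP : forall p, sigma p -> prime p.
Variable U : forall j, set (Gp j).
Arguments U : clear implicits.
Hypothesis GU : forall j,
  [/\ lc_pgroup_on [set: Gp j] (proj1_sig j), tqh_on [set: Gp j],
      subgroup (U j), compact (U j) & open (U j)].
Variable H : tgroup.
Implicit Types (x y h : H) (X Y S : set H) (j k : {p : nat | sigma p}).

Local Notation P := [set t : forall j, Gp j | forall j, U j (t j)].

Variable phi : H -> forall j, Gp j.
Hypothesis phi_mul : forall x y, phi (tg_mul x y) = fun j => tg_mul (phi x j) (phi y j).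
Hypothesis phi_inj : injective phi.
Hypothesis phi_im : forall t : forall j, Gp j, (exists x, phi x = t) <->
  ((forall j, [set: Gp j] (t j)) /\ finite_set [set j | ~ U j (t j)]).
Hypothesis phi_open : open (phi @^-1` P).
Hypothesis phi_homeo : forall W, W `<=` phi @^-1` P ->
  (open W <-> exists O : set (prod_topology (fun j => (Gp j : topologicalType))),
                open O /\ phi @` W = O `&` P).

Let oU j : opensub (U j).
Proof. by case: (GU j). Qed.

Let perGp j : periodic_on [set: Gp j].
Proof. by case: (GU j) => -[]. Qed.

Let tqhGp j : tqh_on [set: Gp j].
Proof. by case: (GU j). Qed.

Let prime_sig j : prime (proj1_sig j).
Proof. by case: j => p sp; exact: sigmaP sp. Qed.

Let pieltGp j (g : Gp j) : pielt (proj1_sig j) g.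
Proof.
by apply/(p_eltP (@perGp j) (@tqhGp j)) => //; case: (GU j) => -[_ h] _ _ _ _; exact: h.
Qed.

Lemma localprodM x y j : phi (x * y) j = phi x j * phi y j.
Proof. exact: (f_equal (fun t : forall j, Gp j => t j) (phi_mul x y)). Qed.

Lemma localprod1 j : phi 1 j = 1.
Proof. by apply: (@mulgI _ (phi 1 j)); rewrite -localprodM !mulg1. Qed.

Lemma localprodV x j : phi x^-1 j = (phi x j)^-1.
Proof. by apply/esym/mulg1_eq; rewrite -localprodM mulgV localprod1. Qed.

Lemma localprodX x n j : phi (x ^+ n) j = phi x j ^+ n.
Proof.
by elim: n => [|n ih]; [rewrite !expg0 localprod1|rewrite !expgS localprodM ih].
Qed.

Lemma localprod_almost_all x :
  exists N, forall j, (N <= proj1_sig j)%N -> U j (phi x j).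
Proof.
have [_ /finite_set_bounded [N xN]] := (phi_im (phi x)).1 (ex_intro _ x erefl).
by exists N => j Nj; apply: contrapT => /xN; rewrite ltnNge Nj.
Qed.

Lemma localprod_single j (g : Gp j) :
  exists h, phi h j = g /\ forall k, k <> j -> phi h k = 1.
Proof.
(* [{classic _}] equips the index type with the decidable equality that [dfwith] tests. *)
pose t : forall k, Gp k :=
  @dfwith {classic {p : nat | sigma p}} Gp (fun k => 1 : Gp k) j g.
have tj : t j = g by exact: (@dfwithin {classic {p : nat | sigma p}}).
have tk k : k <> j -> t k = 1.
  by move=> kj; apply: (@dfwithout {classic {p : nat | sigma p}}); apply/eqP => /esym.
have [|h ht] := (phi_im t).2; last by exists h; rewrite ht.
split=> //; apply/finite_set_bounded; exists (proj1_sig j).+1 => k.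
apply: contra_notT; rewrite -leqNgt => jk; rewrite tk.
  exact: subgroup1 (oU k).2.
by move=> e; rewrite e ltnn in jk.
Qed.

(** After translation to 1, [phi] is a homeomorphism onto the Tychonoff product of the U j, where
    boxes form a base. *)
Lemma localprod_nbhs h S : nbhs h S ->
  exists (N : nat) (V : forall j, set (Gp j)),
    (forall j, nbhs (1 : Gp j) (V j)) /\
    forall h', (forall j, U j ((phi h j)^-1 * phi h' j)) ->
      (forall j, (proj1_sig j < N)%N -> V j ((phi h j)^-1 * phi h' j)) -> S h'.
Proof.
move=> /nbhs_mull1; rewrite nbhsE => -[W0 [oW0 W01] W0S].
pose W := W0 `&` phi @^-1` P.
have oW : open W by exact: openI.
have [O [oO WE]] := (phi_homeo (@subIsetr _ _ _)).1 oW.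
have : (phi @` W) (phi 1).
  exists 1 => //; split => // j; rewrite localprod1; exact: subgroup1 (oU j).2.
rewrite WE => -[O1 _].
have [N [V [V1 VO]]] := prod_topology_basis (open_nbhs_nbhs (conj oO O1)).
exists N, V; split => [j|h' Uh' Vh']; first by have := V1 j; rewrite localprod1.
have e j : phi (h^-1 * h') j = (phi h j)^-1 * phi h' j by rewrite localprodM localprodV.
have : (O `&` P) (phi (h^-1 * h')).
  split; last by move=> j; rewrite e.
  by apply: VO => j jN; rewrite e; exact: Vh'.
rewrite -WE => -[w [W0w _] /phi_inj wE].
by have := W0S _ W0w; rewrite /= wE mulVKg.
Qed.

(** Uses the elements of X supported at j instead of projecting X; [coord_mem] shows that both give
    the same set for a closed subgroup. *)
Definition coord X j : set (Gp j) :=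
  [set g | exists h, [/\ X h, phi h j = g & forall k, k <> j -> phi h k = 1]].
Arguments coord : clear implicits.

Lemma coord_subgroup X j : subgroup X -> subgroup (coord X j).
Proof.
move=> sX; split.
- exists 1; split; [exact: subgroup1|exact: localprod1|].
  by move=> k _; exact: localprod1.
- move=> _ _ [a [Xa <- ak]] [b [Xb <- bk]]; exists (a * b); split.
  + exact: subgroupM.
  + exact: localprodM.
  + by move=> k kj; rewrite localprodM ak // bk // mulg1.
- move=> _ [a [Xa <- ak]]; exists a^-1; split.
  + exact: subgroupV.
  + exact: localprodV.
  + by move=> k kj; rewrite localprodV ak // invg1.
Qed.

(** It is the preimage of X under the embedding of the j-th factor, whose continuity is read off
    from [localprod_nbhs]. *)
Lemma coord_closed X j : closed X -> closed (coord X j).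
Proof.
move=> cX g clg; have [h [hj hk]] := localprod_single g.
exists h; split => //; apply: cX => S /localprod_nbhs [N [V [V1 VS]]].
have nb : nbhs (1 : Gp j) (U j `&` V j).
  by apply: filterI => //; exact: opensub_nbhs.
have [_ [[h' [Xh' <- h'k]] /= [Uh' Vh']]] := clg _ (nbhs_coset g nb).
exists h'; split => //; apply: VS => k.
  have [e|ne] := pselect (k = j); first by subst k; rewrite hj.
  by rewrite hk // h'k // mulVg; exact: subgroup1 (oU k).2.
move=> _; have [e|ne] := pselect (k = j); first by subst k; rewrite hj.
by rewrite hk // h'k // mulVg; exact: nbhs_singleton.
Qed.

(* Suitable powers of x converge to the element whose only nontrivial coordinate is that of x
   at j. *)
Lemma coord_mem X x j : closed X -> subgroup X -> X x -> coord X j (phi x j).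
Proof.
move=> cX sX Xx; have [h [hj hk]] := localprod_single (phi x j).
exists h; split => //; apply: cX => S /localprod_nbhs [N [V [V1 VS]]].
have [N0 xN0] := localprod_almost_all x.
have [e [e_gt0 eP]] := primary_exponents (prime_sig j).
(* Below the bound each coordinate is treated separately: at j the error is a power with exponent e
   n - 1, elsewhere it has exponent e n. [near_below] then yields a common n. *)
have ev i : (i < maxn N N0)%N -> \forall n \near \oo, forall k, proj1_sig k = i ->
    (U k `&` V k) ((phi h k)^-1 * phi x k ^+ e n).
  move=> iM; have [si|nsi] := pselect (sigma i); last first.
    by exists 0%N => // n _ [k sk] /= ki; rewrite -ki in nsi.
  pose k : {p | sigma p} := exist _ i si.
  have kE k' : proj1_sig k' = i -> k' = k by move=> e'; exact: sig_val_inj.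
  have nb : nbhs (1 : Gp k) (U k `&` V k).
    by apply: filterI => //; exact: opensub_nbhs.
  have [V' [oV' _ V'UV]] := opensub_base (@perGp k) nb.
  have [m [pm Vm]] := pieltGp (phi x k) oV'.
  have [kj|kj] := pselect (k = j).
    have [a ma] := p_natP pm.
    have ea := eP a 1%N isT; near=> n => k' /kE ->; apply: V'UV.
    have [pe _] : (proj1_sig j ^ a %| (e n).-1)%N /\ (1 %| e n)%N by near: n.
    have -> : (phi h k)^-1 * phi x k ^+ e n = phi x k ^+ (e n).-1.
      by rewrite -(prednK (e_gt0 n)) expgS -kj in hj *; rewrite hj mulKg.
    apply: (subgroup_expg_dvd oV'.2 Vm); rewrite ma.
    by rewrite -kj in pe.
  have pm' : ((proj1_sig j)^')%N.-nat m.
    apply: sub_in_pnat pm => q _; rewrite !inE => /eqP ->; apply/eqP => e'.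
    by apply: kj; exact: sig_val_inj.
  have ea := eP 0%N m pm'; near=> n => k' /kE ->; apply: V'UV.
  have [_ pe] : (proj1_sig j ^ 0 %| (e n).-1)%N /\ (m %| e n)%N by near: n.
  rewrite hk // invg1 mul1g; exact: (subgroup_expg_dvd oV'.2 Vm).
have [n0 _ /(_ n0 (leqnn _)) hn] := near_below ev.
exists (x ^+ e n0); split; first exact: subgroupX.
(* From N0 on the coordinates of x lie in U k already, whatever the exponent. *)
have big k : (maxn N N0 <= proj1_sig k)%N -> U k ((phi h k)^-1 * phi x k ^+ e n0).
  rewrite geq_max => /andP [_ /xN0 Ux]; have sU := (oU k).2.
  apply: subgroupM => //; last exact: (subgroupX sU).
  apply: subgroupV => //; have [kj|kj] := pselect (k = j); first by subst k; rewrite hj.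
  by rewrite hk //; exact: subgroup1.
apply: VS => k; rewrite localprodX.
  by have [/hn /(_ k erefl) []|/big] := ltnP (proj1_sig k) (maxn N N0).
by move=> kN; have [] := hn (proj1_sig k) (leq_trans kN (leq_maxl _ _)) k erefl.
Unshelve. all: by end_near. Qed.

Lemma localprod_setmul_closure X Y : closed X -> closed Y -> subgroup X -> subgroup Y ->
  setmul X Y `<=` closure (setmul Y X).
Proof.
move=> cX cY sX sY _ [x [y [Xx [Yy ->]]]] S; rewrite tg_mulE.
move=> /localprod_nbhs [N [V [V1 VS]]].
have nb j : nbhs (1 : Gp j) (U j `&` V j).
  by apply: filterI => //; exact: opensub_nbhs.
(* The approximants are built prime by prime and are trivial from n on, so that a correction at the
   next coordinate leaves the earlier ones unchanged. *)
have approx n : exists y' x', [/\ Y y', X x',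
    forall k, (proj1_sig k < n)%N ->
      (U k `&` V k) ((phi (x * y) k)^-1 * (phi y' k * phi x' k)) &
    forall k, (n <= proj1_sig k)%N -> phi y' k = 1 /\ phi x' k = 1].
  elim: n => [|n [y' [x' [Yy' Xx' h1 h2]]]].
    exists 1, 1; split => //; [exact: subgroup1|exact: subgroup1|].
    by move=> k _; rewrite !localprod1.
  have [sn|nsn] := pselect (sigma n); last first.
    have neq k : proj1_sig k <> n by case: k => p sp /= pn; rewrite pn in sp.
    exists y', x'; split => // k kn.
      by apply: h1; move: kn; rewrite ltnS leq_eqVlt => /predU1P[/neq|].
    by apply: h2; exact: ltnW.
  pose j : {p | sigma p} := exist _ n sn.
  have clT Z : closed Z -> closed_in [set: Gp j] Z.
    by move=> /closure_id ZE; rewrite /closed_in setIT -ZE.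
  have := @tqhGp j _ _ (@subsetT _ _) (@subsetT _ _) (coord_subgroup j sX)
    (coord_subgroup j sY) (clT _ (@coord_closed _ j cX)) (clT _ (@coord_closed _ j cY)).
  rewrite !setIT => cl.
  (* Here the quasihamiltonian property of the factor Gp j swaps the order of the two coordinate
     groups. *)
  have : closure (setmul (coord Y j) (coord X j)) (phi (x * y) j).
    rewrite -cl; apply: subset_closure; exists (phi x j), (phi y j).
    by split; [exact: coord_mem|split; [exact: coord_mem|exact: localprodM]].
  move=> /(_ _ (nbhs_coset _ (nb j))) [_ [[_ [_ [[b [Yb <- bk]] [[a [Xa <- ak]] ->]]]] /= UV]].
  have [y'j x'j] := h2 j (leqnn _).
  exists (y' * b), (x' * a); split; [exact: subgroupM|exact: subgroupM| |].
    move=> k kn; rewrite !localprodM; have [kj|kj] := pselect (k = j).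
      by subst k; rewrite y'j x'j !mul1g -localprodM.
    rewrite ak // bk // !mulg1 -localprodM; apply: h1; move: kn.
    by rewrite ltnS leq_eqVlt => /predU1P[kn|//]; case: kj; exact: sig_val_inj.
  move=> k nk; have kj : k <> j by move=> kj; rewrite kj /= ltnn in nk.
  by have [y'k x'k] := h2 k (ltnW nk); rewrite !localprodM y'k x'k ak // bk // !mulg1.
have [Nx xNx] := localprod_almost_all x; have [Ny yNy] := localprod_almost_all y.
(* Beyond this bound the approximants are 1 and the coordinates of x and y lie in U k, so the error
   lies in U k as well. *)
have [y' [x' [Yy' Xx' h1 h2]]] := approx (maxn N (maxn Nx Ny)).
exists (y' * x'); split; first by exists y', x'.
apply: VS => k; rewrite [phi (y' * x') k]localprodM.
  have [/h1 []//|kM] := ltnP (proj1_sig k) (maxn N (maxn Nx Ny)).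
  have [-> ->] := h2 k kM; have sU := (oU k).2.
  move: kM; rewrite !geq_max => /and3P [_ /xNx Ux /yNy Uy].
  rewrite !mulg1 localprodM; apply: subgroupV => //; exact: subgroupM.
by move=> kN; have [] := h1 k (leq_trans kN (leq_maxl _ _)).
Qed.

Lemma localprod_tqh : tqh_on [set: H].
Proof.
move=> X Y _ _ sX sY cX cY; rewrite !setIT.
have cl Z : closed_in [set: H] Z -> closed Z by move=> cZ z zZ; apply: cZ.
apply/seteqP; split; apply: closed_sub_closure; try exact: closed_closure.
  by apply: localprod_setmul_closure => //; exact: cl.
by apply: localprod_setmul_closure => //; exact: cl.
Qed.

End LocalProduct.

Theorem theorem8p4 :
  (forall G : tgroup,
    periodic_on (@setT G) -> tqh_on (@setT G) ->
    (forall p, prime_set G p ->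
       [/\ closed (p_elts G p), subgroup (p_elts G p),
           lc_pgroup_on (p_elts G p) p & tqh_on (p_elts G p)]) /\
    exists U : nat -> set G,
      (forall p, prime_set G p ->
         [/\ U p `<=` p_elts G p, subgroup (U p), compact (U p) &
             rel_open_in (p_elts G p) (U p)]) /\
      localprod_iso G {p : nat | prime_set G p} (fun _ : {p : nat | prime_set G p} => G)
        (fun j => p_elts G (proj1_sig j)) (fun j => U (proj1_sig j)))
  /\
  (forall (sigma : set nat), (forall p, sigma p -> prime p) ->
   forall (Gp : {p : nat | sigma p} -> tgroup)
          (U : forall j, set (Gp j)),
   (forall j, [/\ lc_pgroup_on (@setT (Gp j)) (proj1_sig j),
                  tqh_on (@setT (Gp j)), subgroup (U j), compact (U j) &
                  open (U j)]) ->
   forall H : tgroup,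
     localprod_iso H {p : nat | sigma p} Gp (fun j => @setT (Gp j)) U ->
     tqh_on (@setT H)).
Proof.
split=> [G perG tqhG|sigma sigmaP Gp U GU H [phi [phiM phi_inj phi_im phi_open phi_homeo]]].
  split; last exact: localprod_decomposition.
  move=> p [pp _]; split; [exact: p_elts_closed|exact: p_elts_subgroup|exact: p_elts_lc_pgroup|].
  by apply: tqh_closed => //; exact: p_elts_closed.
exact: (localprod_tqh sigmaP GU phiM phi_inj phi_im phi_open phi_homeo).
Qed.
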